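(* Let $r\ge 3$ be a fixed integer. There exist $\mathcal{E}^{(r)}(m)$-universal ($r$-uniform) hypergraphs with $O(m^r/\ln^r m)$ edges.
   Context: An $r$-uniform hypergraph has a finite vertex set and a set of edges each of which is an $r$-element subset of the vertex set. $\mathcal{E}^{(r)}(m)$ denotes the family of all $r$-uniform hypergraphs with at most $m$ edges and without isolated vertices (every vertex lies in at least one edge). An $r$-uniform hypergraph $H$ is called $\mathcal{F}$-universal, for a family $\mathcal{F}$ of $r$-uniform hypergraphs, if it contains every $F\in\mathcal{F}$ as a copy, i.e. for each $F\in\mathcal{F}$ there is an injective map $V(F)\to V(H)$ sending edges of $F$ to edges of $H$ (the copy need not be induced). The statement is for every $m\geq 2$, asymptotically as $m\to\infty$; the constant in the $O$-notation depends only on $r$. *)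

(* Defs.v *)
From mathcomp Require Import all_boot.

Set Implicit Arguments.
Unset Strict Implicit.
Unset Printing Implicit Defensive.

Record hypergraph (r : nat) := Hypergraph {
  vertex : finType;
  edges : {set {set vertex}};
  edges_uniform : forall e, e \in edges -> #|e| = r
}.

(* Copies need not be induced: only edges of F are constrained. *)
Definition contains_copy (r : nat) (H F : hypergraph r) : Prop :=
  exists f : vertex F -> vertex H,
    injective f /\ forall e, e \in edges F -> f @: e \in edges H.

(* A family of hypergraphs is a predicate, so that it can range over
   hypergraphs on all finite vertex types. *)
Definition universal (r : nat) (Fam : hypergraph r -> Prop)
    (H : hypergraph r) : Prop :=
  forall F : hypergraph r, Fam F -> contains_copy H F.

Definition no_isolated_vertex (r : nat) (F : hypergraph r) : Prop :=
  forall v : vertex F, exists2 e, e \in edges F & v \in e.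

Definition edge_family (r m : nat) (F : hypergraph r) : Prop :=
  #|edges F| <= m /\ no_isolated_vertex F.

(* Main.v *)
Require Import Defs.
From mathcomp Require Import all_boot all_order all_algebra.
From mathcomp Require Import reals exp.
From mathcomp Require Import zify.

Set Implicit Arguments.
Unset Strict Implicit.
Unset Printing Implicit Defensive.

Import Order.TTheory GRing.Theory Num.Theory.

(** The host is a star hypergraph: each vertex [z] carries a set [B z], and the
    edges are the [r]-sets [e] with a centre [z] in [e] such that [e :\ z] is
    contained in [B z]. There are at most [\sum_z #|B z| ^ (r - 1)] of them
    ([card_star_edges]).

    Up to a constant factor, let the number of edges allowed in the guests be
    [M = 2 ^ (8 s)]. A guest [F] has at most [r M / 2 ^ i] vertices of degree at
    least [2 ^ i]. The host has, for each [i < s], a class of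
    [2 r M / 2 ^ i] slots meant for guest vertices with degree in
    [[2 ^ i, 2 ^ i.+1)], and a set of [O(s M ^ (7/8))] spare vertices [z] for
    which [B z] is everything. For a slot [x] of class [i], [B x] is a set
    [A x] of slots of classes at least [i], chosen at random with density
    [1 / q_i], where [q_i = 2 ^ (K %/ 2 ^ i)] and [K] is a power of two of order
    [s / r].

    Edge count: [#|A x|] is at most twice its mean (Markov), so class [i]
    contributes at most about [(M / 2 ^ i) ^ r / q_i ^ (r - 1)], that is
    [(M / K) ^ r] times [y ^ r / 2 ^ ((r - 1) * floor y)] with [y = K / 2 ^ i].
    The last factor decays geometrically in both directions away from [y = 1],
    so the sum over [i] is [O((M / s) ^ r)] ([sum_sparse]); the stars centred at
    spare vertices are negligible.

    Randomness is used once ([exists_hitting_sets]): with positive probability,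
    for every [X] containing at least half of class [i] and every family of
    [t = 2 ^ (5 s)] pairwise disjoint sets [S] of slots of classes at least [i],
    with [#|S| <= r 2 ^ s] and [q_i ^ #|S| <= M ^ (1/2)], some [x] in [X] has [A x]
    containing some [S]. A fixed [x] fails with probability at most
    [2 (1 - M ^ (-1/2)) ^ t], and a union bound over [X] and over the families
    concludes.

    Embedding ([greedy_exists]): the vertices of degree less than [2 ^ s] are
    treated by decreasing class, and [v] is sent to any free slot [x] of its
    class whose set [A x] contains the images of the neighbours of [v] already
    placed; if there is none, [v] fails. Half of each class always remains
    free. Many failures in a class would give [t] failed vertices with pairwise
    disjoint sets of placed neighbours, all degrees being small
    ([disjoint_selection]); the hitting property, applied to the slots that are
    free at the end, would then contradict one of these failures. So the failed
    vertices and those of high degree fit into the spare vertices. An edge of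
    [F] meeting a spare vertex is a star centred there; any other edge is a star
    centred at the image of its vertex treated last ([host_universal]). *)

(** * Finite unions *)

Lemma card_bigcup_leq (I : Type) (T : finType) (r : seq I) (P : pred I)
    (F : I -> {set T}) :
  #|\bigcup_(i <- r | P i) F i| <= \sum_(i <- r | P i) #|F i|.
Proof.
elim/big_rec2: _ => [|i n A _ leA]; first by rewrite cards0.
by rewrite (leq_trans (leq_card_setU _ _)) // leq_add2l.
Qed.

(** * Random subsets as zero sets of random functions *)

Section ZeroSets.
Variables (T : finType) (q : nat).
Implicit Types (P : pred {ffun T -> 'I_q.+1}) (D S Y : {set T}).
Implicit Types ss : seq {set T}.

(** The random subset of [T] of density [1 / q.+1] attached to a uniformly
    distributed function [g]. *)
Definition zeros (g : {ffun T -> 'I_q.+1}) : {set T} := [set y | g y == ord0].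

(** The event [P] does not depend on the values of the function on [D]. *)
Definition insensitive D P :=
  forall g h : {ffun T -> 'I_q.+1}, (forall y, y \notin D -> g y = h y) -> P g = P h.

Lemma insensitiveW D D' P : D \subset D' -> insensitive D' P -> insensitive D P.
Proof.
move=> sDE insP g h gh; apply: insP => y yE; apply: gh.
by apply: contra yE; apply: (subsetP sDE).
Qed.

Lemma insensitiveI D P1 P2 :
  insensitive D P1 -> insensitive D P2 -> insensitive D (fun g => P1 g && P2 g).
Proof. by move=> i1 i2 g h gh; rewrite (i1 g h gh) (i2 g h gh). Qed.

Lemma insensitive_sub_zeros D S :
  [disjoint D & S] -> insensitive D (fun g => S \subset zeros g).
Proof.
move=> dis g h gh; apply/subsetP/subsetP => sS y yS; have := sS y yS;
  by rewrite !inE gh // (disjointFl dis).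
Qed.

Lemma card_zero_at P y : insensitive [set y] P ->
  #|[set g | P g & y \in zeros g]| * q.+1 = #|[set g | P g]|.
Proof.
move=> insP; apply/esym.
have fiber c : #|[set g | P g & g y == c]| = #|[set g | P g & y \in zeros g]|.
  (* Exchanging the values [ord0] and [c] at [y] preserves [P]. *)
  pose sw (g : {ffun T -> 'I_q.+1}) : {ffun T -> 'I_q.+1} :=
    [ffun z => if z == y then
       (if g z == c then ord0 else if g z == ord0 then c else g z) else g z].
  have swK : involutive sw.
    move=> g; apply/ffunP=> z; rewrite !ffunE; case: eqP => // _.
    have [->|/negPf gc] := eqVneq (g z) c; first by rewrite eqxx; case: eqP.
    by have [->|/negPf g0] := eqVneq (g z) ord0; rewrite ?eqxx ?gc ?g0.
  rewrite -(card_imset _ (inv_inj swK)); apply: eq_card => g.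
  rewrite -[g in LHS]swK (mem_imset _ _ (inv_inj swK)) !inE ffunE eqxx.
  rewrite (insP (sw g) g); last first.
    by move=> z; rewrite inE ffunE => /negPf->.
  congr andb.
  have [->|gc] := eqVneq (g y) c; first exact: eq_sym.
  by case: (eqVneq (g y) ord0) => [_|_]; rewrite ?eqxx // (negPf gc).
rewrite -sum1dep_card (partition_big (fun g : {ffun T -> 'I_q.+1} => g y) xpredT) //=.
rewrite (eq_bigr (fun=> #|[set g | P g & y \in zeros g]|)); last first.
  by move=> c _; rewrite sum1dep_card fiber.
by rewrite sum_nat_const card_ord mulnC.
Qed.

(** The inclusion of [S] in [zeros g] has probability [1 / q.+1 ^ #|S|] and is
    independent of any event that does not depend on the values on [S]. *)
Lemma card_sub_zeros P S : insensitive S P ->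
  #|[set g | P g & S \subset zeros g]| * q.+1 ^ #|S| = #|[set g | P g]|.
Proof.
move: {2}#|S| (leqnn #|S|) => n; elim: n S => [|n IHn] S leSn insP.
  move: leSn; rewrite leqn0 cards_eq0 => /eqP->; rewrite cards0 expn0 muln1.
  by apply: eq_card => g; rewrite !inE sub0set andbT.
have [->|[y yS]] := set_0Vmem S.
  rewrite cards0 expn0 muln1.
  by apply: eq_card => g; rewrite !inE sub0set andbT.
rewrite (cardsD1 y) yS add1n expnS mulnA.
have <- : #|[set g | P g & S :\ y \subset zeros g]| * q.+1 ^ #|S :\ y| = #|[set g | P g]|.
  apply: IHn; first by move: leSn; rewrite (cardsD1 y) yS.
  by apply: insensitiveW insP; apply: subD1set.
congr (_ * _).
rewrite -[RHS](@card_zero_at (fun g => P g && (S :\ y \subset zeros g)) y); last first.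
  apply: insensitiveI; first by apply: insensitiveW insP; rewrite sub1set.
  by apply: insensitive_sub_zeros; rewrite disjoints1 !inE eqxx.
congr (_ * _); apply: eq_card => g; rewrite !inE -andbA; congr andb.
by rewrite -{1}(setD1K yS) subUset sub1set inE andbC.
Qed.

(** No set of the family [ss] is contained in [zeros g]. *)
Definition misses ss g := all (fun S => ~~ (S \subset zeros g)) ss.

Lemma insensitive_misses D ss :
  all (fun S => [disjoint D & S]) ss -> insensitive D (misses ss).
Proof.
move=> dis g h gh; apply: eq_in_all => S Sss; congr negb.
exact: (insensitive_sub_zeros (allP dis S Sss) gh).
Qed.

(** For pairwise disjoint sets the inclusions are independent, so that [misses ss]
    has probability at most [(1 - 1 / Q.+1) ^ size ss]. *)
Lemma card_misses Q ss :
    pairwise (fun S S' => [disjoint S & S']) ss ->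
    all (fun S => q.+1 ^ #|S| <= Q.+1) ss ->
  #|[set g | misses ss g]| * Q.+1 ^ size ss <= #|{ffun T -> 'I_q.+1}| * Q ^ size ss.
Proof.
elim: ss => [|S ss IH] /=; first by rewrite !expn0 !muln1 max_card.
move=> /andP[disS /IH{}IH] /andP[leSQ /IH{}IH].
set B := #|[set g | misses ss g]| in IH.
have split_ : #|[set g | misses (S :: ss) g]|
    + #|[set g | misses ss g & S \subset zeros g]| = B.
  rewrite /B -[RHS](cardsID [set g | S \subset zeros g]) addnC; congr (_ + _).
    by apply: eq_card => g; rewrite !inE.
  by apply: eq_card => g; rewrite !inE.
have insS : insensitive S (misses ss) by apply: insensitive_misses.
have := card_sub_zeros insS; rewrite -/B => cardS.
set x := #|[set g | misses (S :: ss) g]| in split_ *.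
set z := #|[set g | misses ss g & S \subset zeros g]| in split_ cardS.
have zB : B <= z * Q.+1 by rewrite -cardS leq_mul2l leSQ orbT.
have xB : x * Q.+1 <= B * Q by nia.
rewrite !expnS mulnA (leq_trans (leq_mul xB (leqnn _))) //.
by rewrite mulnAC [leqRHS]mulnCA mulnC leq_mul2l IH orbT.
Qed.

(** Markov's inequality: with probability at least one half, [Y :&: zeros g] has at
    most twice its expected size. *)
Lemma card_few_zeros Y :
  #|{ffun T -> 'I_q.+1}| <= 2 * #|[set g | #|Y :&: zeros g| * q.+1 <= 2 * #|Y|]|.
Proof.
have [->|Y0] := eqVneq Y set0.
  rewrite cards0 (_ : [set _ | _] = setT) ?cardsT ?leq_pmull //.
  by apply/setP=> g; rewrite !inE set0I cards0.
have Ygt0 : 0 < #|Y| by rewrite card_gt0.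
pose N := #|{ffun T -> 'I_q.+1}|.
have tot : (\sum_(g : {ffun T -> 'I_q.+1}) #|Y :&: zeros g|) * q.+1 = #|Y| * N.
  have slices (g : {ffun T -> 'I_q.+1}) :
      #|Y :&: zeros g| = \sum_(y in Y) (if y \in zeros g then 1 else 0).
    by rewrite -big_mkcondr -sum1_card; apply: eq_bigl => y; rewrite inE.
  under eq_bigr do rewrite slices.
  rewrite exchange_big /= big_distrl /= -sum_nat_const; apply: eq_bigr => y _.
  rewrite -big_mkcond /= sum1dep_card.
  have := @card_zero_at xpredT y; rewrite /insensitive => /(_ (fun _ _ _ => erefl)).
  have -> : [set g : {ffun T -> 'I_q.+1} | true] = setT by apply/setP=> g; rewrite !inE.
  rewrite cardsT /N => <-; congr (_ * _); apply: eq_card => g.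
set G := [set g | _].
have compl : #|G| + #|~: G| = N by rewrite cardsC.
have bad : #|~: G| * (2 * #|Y|) <= #|Y| * N.
  rewrite -tot big_distrl /= -sum_nat_const.
  rewrite [leqRHS](bigID (fun g => g \in ~: G)) /= (leq_trans _ (leq_addr _ _)) //.
  by apply: leq_sum => g; rewrite !inE -ltnNge => /ltnW.
rewrite -/N; nia.
Qed.

End ZeroSets.

(** * Random sets hitting all small families *)

(** Sets of at most [d] elements are listed, with possible gaps, by functions
    ['I_d -> option T]; this bounds their number by [#|T|.+1 ^ d]. *)
Definition decode_set (T : finType) d (c : {ffun 'I_d -> option T}) : {set T} :=
  [set x | Some x \in codom c].

Lemma decode_set_surj (T : finType) d (S : {set T}) :
  #|S| <= d -> exists c : {ffun 'I_d -> option T}, S = decode_set c.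
Proof.
move=> leSd; exists [ffun i : 'I_d => nth None (map Some (enum S)) i].
apply/setP=> x; rewrite inE; apply/idP/codomP => [xS|[i]]; last first.
  rewrite ffunE; have [ltiS|leSi] := ltnP i (size (enum S)); last first.
    by rewrite nth_default ?size_map.
  rewrite (nth_map x) // => -[->].
  by rewrite -mem_enum mem_nth.
have ltx : index x (enum S) < size (enum S) by rewrite index_mem mem_enum.
have ltd : index x (enum S) < d by rewrite (leq_trans ltx) // -cardE.
exists (Ordinal ltd); rewrite ffunE (nth_map x) //= nth_index //.
by rewrite mem_enum.
Qed.

Lemma decode_seq_surj (T : finType) d (ss : seq {set T}) :
    all (fun S : {set T} => #|S| <= d) ss ->
  exists c : (size ss).-tuple {ffun 'I_d -> option T},
    ss = map (@decode_set T d) c.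
Proof.
elim: ss => [|S ss IH] /=; first by exists [tuple].
move=> /andP[/decode_set_surj[c ->] /IH[cs defss]].
by exists [tuple of c :: cs]; rewrite /= -defss.
Qed.

Section Hitting.
Variables (T : finType) (q Q t d n : nat) (C Y : {set T}).

(** A family of pairwise disjoint subsets of [Y] of size at most [d], each of
    which is contained in a random set of density [1 / q.+1] with probability at
    least [1 / Q.+1]. *)
Definition small_family (ss : seq {set T}) :=
  [&& pairwise (fun S S' : {set T} => [disjoint S & S']) ss,
      all (fun S : {set T} => S \subset Y) ss, all (fun S : {set T} => #|S| <= d) ss
    & all (fun S : {set T} => q.+1 ^ #|S| <= Q.+1) ss].

(** For every large part [X] of [C] and every small family of [t] sets, some
    [A x] with [x] in [X] contains a member of the family. *)
Definition hitting (A : T -> {set T}) : Prop :=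
  forall (X : {set T}) (ss : seq {set T}),
    X \subset C -> n <= #|X| -> size ss = t -> small_family ss ->
    exists2 x, x \in X & exists2 S, S \in ss & S \subset A x.

(** By a union bound: for a given [x], Markov's inequality costs a factor two, so
    that [A x] misses a given family with probability at most [1 / 16]; there are
    at most [4 ^ n] sets [X] and fewer than [4 ^ n] families. *)
Lemma exists_hitting_sets :
    #|C| <= 2 * n -> 32 * Q ^ t <= Q.+1 ^ t -> (#|T|.+1 ^ d) ^ t < 4 ^ n ->
  exists A : {ffun T -> {set T}},
    (forall x, #|A x| * q.+1 <= 2 * #|Y|) /\ hitting A.
Proof.
move=> leC leQ lt4.
pose gT := {ffun T -> 'I_q.+1}.
pose G : {set gT} := [set g | #|Y :&: zeros g| * q.+1 <= 2 * #|Y|].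
have Gbig : #|{: gT}| <= 2 * #|G| := card_few_zeros q Y.
have Ggt0 : 0 < #|G|.
  have : 0 < #|{: gT}| by apply/card_gt0P; exists [ffun=> ord0].
  by move: Gbig; lia.
(* The sample space: one function of [G] for each [x], with [A x] the part in [Y]
   of its set of zeros. *)
pose Om : {set {ffun T -> gT}} := [set a | a \in family (fun=> mem G)].
have cardF (F : T -> {set gT}) :
    #|[set a : {ffun T -> gT} | a \in family (fun x => mem (F x))]| = \prod_x #|F x|.
  rewrite (_ : #|_| = #|family (fun x => mem (F x))|); last first.
    by apply: eq_card => a; rewrite inE.
  by rewrite card_family foldrE big_map big_enum.
pose codeT := ({set T} * t.-tuple {ffun 'I_d -> option T})%type.
pose dec (c : t.-tuple {ffun 'I_d -> option T}) := map (@decode_set T d) c.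
pose valid : {set codeT} :=
  [set k : codeT | [&& k.1 \subset C, n <= #|k.1| & small_family (dec k.2)]].
pose bad (k : codeT) : {set {ffun T -> gT}} :=
  [set a in Om | [forall x in k.1, misses (dec k.2) (a x)]].
have cardOm : #|Om| = #|G| ^ #|T| by rewrite cardF prod_nat_const.
have cardbad k : k \in valid -> #|bad k| * 16 ^ n <= #|Om|.
  rewrite inE; case: k => X c /=; rewrite /bad /= => /and3P[sXC leX /and4P[dis _ _ leSQ]].
  pose M : {set gT} := [set g in G | misses (dec c) g].
  have leM : #|M| * 16 <= #|G|.
    have := card_misses dis leSQ; rewrite size_map size_tuple => cm.
    have sM : #|M| <= #|[set g : gT | misses (dec c) g]|.
      by apply: subset_leq_card; apply/subsetP=> g; rewrite !inE => /andP[].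
    have Qt : 0 < Q.+1 ^ t by rewrite expn_gt0.
    rewrite -(leq_pmul2r Qt); move: cm Gbig leQ sM Qt.
    set u := #|[set g : gT | _]|; set z := Q ^ t; set w := Q.+1 ^ t.
    set g := #|G|; set a := #|{: gT}|; set b := #|M| => *.
    apply: (@leq_trans (16 * (a * z))); first by nia.
    apply: (@leq_trans (16 * (2 * g * z))); first by nia.
    by nia.
  pose F x := if x \in X then M else G.
  have -> : [set a in Om | [forall x in X, misses (dec c) (a x)]]
      = [set a : {ffun T -> gT} | a \in family (fun x => mem (F x))].
    apply/setP=> a; rewrite !inE; apply/andP/familyP => [[/familyP Ga /forall_inP ma] x|Fa].
      rewrite /F; case: ifP => xX; last exact: Ga.
      by rewrite inE; apply/andP; split; [exact: Ga | exact: ma].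
    split; [apply/familyP=> x|apply/forall_inP=> x xX]; have := Fa x; rewrite /F.
      by case: ifP => // _; rewrite inE => /andP[].
    by rewrite xX inE => /andP[].
  rewrite cardF cardOm; apply: (@leq_trans (\prod_x #|F x| * 16 ^ #|X|)).
    by rewrite leq_mul2l leq_pexp2l // orbT.
  have <- : \prod_(x in X) 16 = 16 ^ #|X| by rewrite prod_nat_const.
  have <- : \prod_(x : T) #|G| = #|G| ^ #|T| by rewrite prod_nat_const.
  rewrite [X in _ * X]big_mkcond /= -big_split /=.
  apply: leq_prod => x _; rewrite /F; case: ifP => // _; by rewrite muln1.
have ltvalid : #|valid| < 16 ^ n.
  apply: (@leq_ltn_trans (#|powerset C| * #|{: t.-tuple {ffun 'I_d -> option T}}|)).
    rewrite -cardX; apply: subset_leq_card; apply/subsetP=> -[X c].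
    by rewrite inE => /and3P[XC _ _]; rewrite inE /= powersetE XC.
  rewrite card_powerset card_tuple card_ffun card_option card_ord.
  rewrite (_ : 16 ^ n = 2 ^ (2 * n) * 4 ^ n); last by rewrite expnM -expnMn.
  apply: (@leq_ltn_trans (2 ^ (2 * n) * (#|T|.+1 ^ d) ^ t)).
    by rewrite leq_mul2r leq_pexp2l ?orbT.
  by rewrite ltn_pmul2l ?expn_gt0.
have : ~~ (Om \subset \bigcup_(k in valid) bad k).
  apply/negP=> /subset_leq_card /leq_trans /(_ (card_bigcup_leq _ _ _)) leOm.
  have Omgt0 : 0 < #|Om| by rewrite cardOm expn_gt0 Ggt0.
  have : #|Om| * 16 ^ n <= #|valid| * #|Om|.
    apply: (leq_trans (leq_mul leOm (leqnn _))).
    by rewrite big_distrl /= -sum_nat_const; apply: leq_sum.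
  by rewrite mulnC leq_pmul2r // leqNgt ltvalid.
case/subsetPn=> a aOm notbad; exists [ffun x => Y :&: zeros (a x)].
have Ga x : a x \in G by move: aOm; rewrite inE => /familyP.
split=> [x|X ss sXC leX szss small].
  by have := Ga x; rewrite ffunE inE.
have [_ sY led _] := and4P small.
have [c defss] := decode_seq_surj led; rewrite szss in c defss.
have kvalid : (X, c) \in valid by rewrite inE /= sXC leX /dec -defss.
have : a \notin bad (X, c).
  by apply: contra notbad => abad; apply/bigcupP; exists (X, c).
rewrite inE aOm /= => /forall_inPn[x xX].
rewrite /dec -defss -has_predC => /hasP[S Sss /= /negPn SA].
exists x => //; exists S => //; rewrite ffunE subsetI SA andbT.
exact: (allP sY).
Qed.
End Hitting.

(** * The greedy embedding *)

(** If the sets [S v] are small and no point lies in many of them, pairwise disjoint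
    ones can be picked greedily. *)
Lemma disjoint_selection (V T : finType) (S : V -> {set T}) a b t (Z : {set V}) :
    (forall v, v \in Z -> S v != set0 /\ #|S v| <= a) ->
    (forall y, #|[set v in Z | y \in S v]| <= b) ->
    t * (a * b) < #|Z| ->
  exists vs : seq V, [/\ size vs = t, {subset vs <= Z}
    & pairwise (fun A B : {set T} => [disjoint A & B]) (map S vs)].
Proof.
elim: t Z => [|t IHt] Z ZS Zb ltZ; first by exists [::].
have /card_gt0P[v vZ] : 0 < #|Z| by apply: leq_ltn_trans ltZ.
(* [M] collects the vertices whose set meets [S v], among them [v] itself. *)
pose M := \bigcup_(y in S v) [set u in Z | y \in S u].
have leM : #|M| <= a * b.
  apply: leq_trans (card_bigcup_leq _ _ _) _.
  have [_ leSv] := ZS v vZ; rewrite (leq_trans _ (leq_mul leSv (leqnn b))) //.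
  by rewrite -sum_nat_const; apply: leq_sum => y _; apply: Zb.
have [|y||vs [szvs vsZ dis]] := IHt (Z :\: M).
- by move=> u /setDP[/ZS].
- apply: leq_trans (Zb y); apply: subset_leq_card.
  by apply/subsetP=> u; rewrite !inE => /andP[/andP[_ ->] ->].
- have := cardsID M Z; have := subset_leq_card (subsetIr Z M).
  by rewrite mulSn in ltZ; lia.
exists (v :: vs); split; first by rewrite /= szvs.
  by move=> u; rewrite inE => /predU1P[->//|/vsZ/setDP[]].
rewrite /= dis andbT all_map; apply/allP=> u /vsZ /setDP[uZ uM] /=.
rewrite -setI_eq0; apply: contraR uM => /set0Pn[y /setIP[yv yu]].
by apply/bigcupP; exists y => //; rewrite inE uZ.
Qed.

Section Greedy.

(* [V] and [E] are the vertices and edges of the guest, [T] is the set of slots,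
   [cl] and [c] give the classes, and [A] the stars of the slots. *)
Variables (V T : finType) (E : {set {set V}}) (cl : V -> nat) (c : T -> nat).
Variable A : T -> {set T}.

(** The vertices sharing an edge with [v], including [v] itself if it is not
    isolated. *)
Definition neighbours v : {set V} := \bigcup_(e in E | v \in e) e.

Lemma neighbours_sym u v : (u \in neighbours v) = (v \in neighbours u).
Proof.
by apply/bigcupP/bigcupP=> -[e /andP[eE ue] ve]; exists e; rewrite // eE.
Qed.

(** The outcome [f] of the greedy embedding of the vertices of [s]: [None] is the
    value at the vertices outside [s] and at those that failed. In [greedy_fail],
    [S] is the set of images of the neighbours placed before [v] was treated; no
    slot of its class that is free at the end could receive [v]. *)
Record greedy_state (s : seq V) (f : V -> option T) : Prop := GreedyState {
  greedy_inj : forall u v x, f u = Some x -> f v = Some x -> u = v;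
  greedy_class : forall v x, f v = Some x -> v \in s /\ c x = cl v;
  greedy_edge : forall e, e \in E -> e != set0 -> (forall u, u \in e -> f u != None) ->
    exists2 v, v \in e & exists2 x, f v = Some x &
      forall u y, u \in e -> u != v -> f u = Some y -> y \in A x;
  greedy_fail : forall v, v \in s -> f v = None -> exists2 S : {set T},
    forall y, y \in S -> cl v <= c y /\ exists2 u, u \in neighbours v & f u = Some y
    & forall x, c x = cl v -> (forall u, f u <> Some x) -> ~~ (S \subset A x)
}.

(** The list [s] is treated from its end, hence by decreasing class. *)
Lemma greedy_exists s : uniq s -> pairwise (fun u v => cl u <= cl v) s ->
  exists f, greedy_state s f.
Proof.
elim: s => [|v s IH] /=.
  move=> _ _; exists (fun=> None); split=> // e _ /set0Pn[u ue] /(_ u ue).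
  by rewrite eqxx.
move=> /andP[vs us] /andP[/allP clv pw]; have [f [finj fcl fE ffail]] := IH us pw.
have fv : f v = None by case fv: (f v) => [x|//]; case: (fcl _ _ fv) => /idPn.
pose S := [set y | [exists u in neighbours v, f u == Some y]].
have clS y : y \in S -> cl v <= c y /\ exists2 u, u \in neighbours v & f u = Some y.
  rewrite inE => /exists_inP[u uv /eqP fu]; split; last by exists u.
  by have [us' ->] := fcl _ _ fu; apply: clv.
have [/existsP[x /and3P[/eqP cx xfree SA]]|none] :=
    boolP [exists x, [&& c x == cl v, [forall u, f u != Some x] & S \subset A x]].
  have free u : f u <> Some x by move/eqP; apply/negP; exact: (forallP xfree).
  exists (fun u => if u == v then Some x else f u); split.
  - move=> u w y; case: eqP => [->|_]; case: eqP => [->|_] //.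
    + by move=> [<-] /free.
    + by move=> fu [yx]; case: (free u); rewrite yx.
    + exact: finj.
  - move=> u y; case: eqP => [-> [<-]|_ /fcl[us' cy]].
      by rewrite mem_head.
    by rewrite inE us' orbT.
  - move=> e eE e0 fe; have [ve|ve] := boolP (v \in e).
      exists v => //; exists x; first by rewrite eqxx.
      move=> u y ue uv; rewrite (negPf uv) => fu; apply: (subsetP SA).
      rewrite inE; apply/exists_inP; exists u; last by rewrite fu.
      by apply/bigcupP; exists e; rewrite ?eE.
    have neq u : u \in e -> (u == v) = false.
      by move=> ue; apply: contraNF ve => /eqP <-.
    have [u ue|w we [z fw zA]] := fE e eE e0; first by have := fe u ue; rewrite neq.
    exists w => //; exists z; first by rewrite neq.
    by move=> u y ue uw; rewrite neq //; exact: zA.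
  - move=> u; rewrite inE; case: eqP => //= _ us' fu.
    have [S' S'P S'A] := ffail u us' fu; exists S'.
      move=> y /S'P[cly [w wu fw]]; split=> //; exists w => //.
      by case: eqP => // wv; rewrite wv fv in fw.
    move=> z cz zfree; apply: S'A => // w fw; apply: (zfree w).
    by case: eqP => // wv; rewrite wv fv in fw.
exists f; split=> //.
- by move=> u x /fcl[us' ->]; rewrite inE us' orbT.
- move=> u; rewrite inE => /predU1P[->|] => [_|]; last exact: ffail.
  exists S => // x cx xfree; apply: contra none => SA; apply/existsP; exists x.
  rewrite cx eqxx SA andbT /=; apply/forallP=> w; apply/eqP; exact: xfree.
Qed.

(** More than [t * d ^ 2] failures in class [i] would yield [t] failed vertices with
    pairwise disjoint sets [S], while [n] slots of the class are still free. *)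
Lemma greedy_few_failures s f i q Q t d n :
    greedy_state s f -> 0 < n ->
    2 * n <= #|[set x | c x == i]| -> #|[set v in s | cl v == i]| <= n ->
    (forall v, v \in s -> #|neighbours v| <= d) ->
    (forall v, v \in s -> cl v = i -> q.+1 ^ #|neighbours v| <= Q.+1) ->
    hitting q Q t d n [set x | c x == i] [set x | i <= c x] A ->
  #|[set v in s | (cl v == i) && (f v == None)]| <= t * (d * d).
Proof.
move=> [finj fcl _ ffail] n0 leC les led leQ hit; rewrite leqNgt; apply/negP=> ltZ.
set Z := [set v in s | _] in ltZ.
have /fin_all_exists[S SP] : forall v, exists S : {set T}, v \in Z ->
    (forall y, y \in S -> cl v <= c y /\ exists2 u, u \in neighbours v & f u = Some y)
    /\ forall x, c x = cl v -> (forall u, f u <> Some x) -> ~~ (S \subset A x).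
  move=> v; have [|vZ] := boolP (v \in Z); last by exists set0.
  by rewrite inE => /and3P[vs _ /eqP /(ffail _ vs)[S]]; exists S.
pose X := [set x | (c x == i) && [forall u, f u != Some x]].
have Xfree x : x \in X -> forall u, f u <> Some x.
  by rewrite inE => /andP[_ /forallP xfree] u /eqP; apply/negP.
have leX : n <= #|X|.
  have : #|[set x | c x == i] :\: X| <= n.
    apply: leq_trans les; apply: leq_trans (leq_imset_card f _).
    rewrite -(card_imset _ (@Some_inj _)); apply: subset_leq_card.
    apply/subsetP=> _ /imsetP[x /setDP[+ +] ->]; rewrite !inE => cx; rewrite cx /=.
    case/forallPn=> u; rewrite negbK => /eqP fu; have [us cxu] := fcl _ _ fu.
    by apply/imsetP; exists u; rewrite ?fu // inE us -cxu.
  have := cardsID X [set x | c x == i].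
  have := subset_leq_card (subsetIr [set x | c x == i] X); lia.
have [x0 x0X] : exists x, x \in X by apply/card_gt0P; apply: leq_trans leX.
have clX x v : x \in X -> v \in Z -> c x = cl v.
  by rewrite !inE => /andP[/eqP-> _] /and3P[_ /eqP-> _].
have Zs v : v \in Z -> v \in s by rewrite inE => /andP[].
have leS v : v \in Z -> #|S v| <= #|neighbours v|.
  move=> vZ; apply: leq_trans (leq_imset_card f _).
  rewrite -(card_imset _ (@Some_inj _)); apply: subset_leq_card.
  apply/subsetP=> _ /imsetP[y yS ->]; have [/(_ y yS)[_ [u uv <-]] _] := SP v vZ.
  exact: imset_f.
have [v vZ|y|//|vs [szvs vsZ dis]] := @disjoint_selection V T S d d t Z.
- split; last by rewrite (leq_trans (leS v vZ)) ?led ?Zs.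
  apply/negP=> /eqP Sv0; have [_ /(_ x0)] := SP v vZ.
  by rewrite Sv0 sub0set => /(_ (clX _ _ x0X vZ) (Xfree _ x0X)).
- have [->|[v0]] := set_0Vmem [set v in Z | y \in S v]; first by rewrite cards0.
  rewrite inE => /andP[v0Z yv0].
  have [/(_ y yv0)[_ [u _ fu]] _] := SP v0 v0Z.
  have [us _] := fcl _ _ fu.
  apply: leq_trans (led u us); apply: subset_leq_card; apply/subsetP=> v.
  rewrite inE => /andP[vZ yv]; have [/(_ y yv)[_ [w wv fw]] _] := SP v vZ.
  by rewrite neighbours_sym (finj u w y).
have [|||x xX [_ /mapP[v /vsZ vZ ->] SA]] := hit X (map S vs) _ leX.
- by apply/subsetP=> x; rewrite !inE => /andP[].
- by rewrite size_map.
- rewrite /small_family dis /= !all_map; apply/and3P; split; apply/allP=> v /vsZ vZ /=.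
  + apply/subsetP=> y yS; have [/(_ y yS)[+ _] _] := SP v vZ.
    by move: vZ; rewrite !inE => /and3P[_ /eqP-> _].
  + by rewrite (leq_trans (leS v vZ)) ?led ?Zs.
  + rewrite (leq_trans _ (leQ v (Zs v vZ) _)) ?leq_pexp2l ?leS //.
    by move: vZ; rewrite !inE => /and3P[_ /eqP-> _].
have [_ /(_ x (clX _ _ xX vZ) (Xfree _ xX))] := SP v vZ.
by rewrite SA.
Qed.
End Greedy.

(** * Star hypergraphs *)

Section Star.
Variables (U : finType) (B : U -> {set U}) (r : nat).

(** The [r]-sets having a centre [z] such that all other elements lie in [B z]. *)
Definition star_edges : {set {set U}} :=
  [set e : {set U} | (#|e| == r) && [exists z in e, e :\ z \subset B z]].

Lemma star_edges_uniform e : e \in star_edges -> #|e| = r.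
Proof. by rewrite inE => /andP[/eqP]. Qed.

Definition star_hypergraph : hypergraph r := Hypergraph star_edges_uniform.

Lemma bin_leq_exp n k : 'C(n, k) <= n ^ k.
Proof.
have ffact_leq : n ^_ k <= n ^ k.
  elim: k n => // k IHk [|n]; first by rewrite ffact0n.
  rewrite ffactSS expnS leq_mul2l /= (leq_trans (IHk n)) //.
  by case: k {IHk} => // k; rewrite leq_exp2r.
by rewrite (leq_trans _ ffact_leq) // -bin_ffact leq_pmulr // fact_gt0.
Qed.

Lemma card_star_edges : #|star_edges| <= \sum_z #|B z| ^ r.-1.
Proof.
pose stars z := [set z |: e | e in [set e : {set U} | e \subset B z & #|e| == r.-1]].
apply: (@leq_trans #|\bigcup_z stars z|).
  apply: subset_leq_card; apply/subsetP=> e; rewrite inE => /andP[/eqP er].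
  case/exists_inP=> z ze eB; apply/bigcupP; exists z => //.
  apply/imsetP; exists (e :\ z); last by rewrite setD1K.
  by rewrite inE eB -er (cardsD1 z e) ze add1n eqxx.
apply: leq_trans (card_bigcup_leq _ _ _) _; apply: leq_sum => z _.
by rewrite (leq_trans (leq_imset_card _ _)) // cards_draws bin_leq_exp.
Qed.

End Star.

(** * Degrees *)

Section Degree.
Variables (r : nat) (F : hypergraph r).

Definition degree (v : vertex F) := #|[set e in edges F | v \in e]|.

Lemma sum_degree : \sum_v degree v = #|edges F| * r.
Proof.
rewrite -sum_nat_const.
under eq_bigr do rewrite /degree -sum1dep_card.
rewrite (exchange_big_dep (mem (edges F))) /=; last by move=> v e _ /andP[].
apply: eq_bigr => e eF; rewrite -[RHS](edges_uniform eF) -sum1_card.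
by apply: eq_bigl => v; rewrite eF.
Qed.

Lemma card_degree_geq m k (D : {set vertex F}) :
    #|edges F| <= m -> (forall v, v \in D -> k <= degree v) ->
  #|D| * k <= r * m.
Proof.
move=> leEm Dk; rewrite (@leq_trans (\sum_v degree v)) //; last first.
  by rewrite sum_degree mulnC leq_mul2l leEm orbT.
rewrite -sum_nat_const [leqRHS](bigID (mem D)) /= (leq_trans _ (leq_addr _ _)) //.
exact: leq_sum.
Qed.

Lemma card_neighbours (v : vertex F) : #|neighbours (edges F) v| <= r * degree v.
Proof.
apply: leq_trans (card_bigcup_leq _ _ _) _.
rewrite /degree mulnC -sum_nat_const; apply: eq_leq.
apply: congr_big => // e; first by rewrite inE.
by move=> /andP[/edges_uniform].
Qed.

Lemma degree_gt0 : no_isolated_vertex F -> forall v : vertex F, 0 < degree v.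
Proof.
move=> iso v; have [e eF ve] := iso v; apply/card_gt0P; exists e.
by rewrite inE eF.
Qed.

End Degree.

(** * Numerical inequalities *)

Lemma sum_half_powers N i k : i <= k <= N ->
  \sum_(i <= j < k) 2 ^ (N - j) <= 2 * 2 ^ (N - i).
Proof.
move=> /andP[leik lekN].
suff <- : \sum_(i <= j < k) 2 ^ (N - j) + 2 * 2 ^ (N - k) = 2 * 2 ^ (N - i) by apply: leq_addr.
elim: k leik lekN => [|k IHk].
  by rewrite leqn0 => /eqP-> _; rewrite big_geq.
rewrite leq_eqVlt => /predU1P[-> _|leik ltkN]; first by rewrite big_geq.
rewrite big_nat_recr //= -IHk ?(ltnW ltkN) // -addnA; congr (_ + _).
have -> : N - k = (N - k.+1).+1 by lia.
by rewrite expnS; lia.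
Qed.

(** That is, [(1 - 1 / Q.+1) ^ Q.+1 <= 1 / 2]. *)
Lemma double_exp_pred Q : 0 < Q -> 2 * Q ^ Q.+1 <= Q.+1 ^ Q.+1.
Proof.
move=> Q0.
(* Bernoulli's inequality for [(Q + 1) ^ k.+1] *)
suff lin k : Q ^ k.+1 + k.+1 * Q ^ k <= Q.+1 ^ k.+1.
  have := lin Q; rewrite (expnS Q Q); nia.
elim: k => [|k IHk]; first by rewrite !expn1 expn0; lia.
rewrite (expnS Q.+1) (leq_trans _ (leq_mul (leqnn Q.+1) IHk)) //.
by rewrite !(expnS Q); nia.
Qed.

Lemma exp_leq_exp2 s k : s ^ k <= k ^ k * 2 ^ s.
Proof.
case: k => [|k]; first by rewrite !expn0 mul1n expn_gt0.
have le1 : s <= k.+1 * 2 ^ (s %/ k.+1).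
  have := ltn_ceil s (ltn0Sn k); have := ltn_expl (s %/ k.+1) (ltnSn 1); nia.
have := leq_exp2r s (k.+1 * 2 ^ (s %/ k.+1)) (ltn0Sn k).
rewrite le1 expnMn -expnM => /leq_trans-> //.
by rewrite leq_mul2l leq_exp2l // leq_divM orbT.
Qed.

(** * The host hypergraph *)

Section Host.
Variables (r s : nat).
Hypotheses (r_gt0 : 0 < r) (r_le_s : r <= s) (s_big : 9 * s < 2 ^ s).

(** With at most [2 ^ (8 * s)] edges, a guest has at most [class_bound i] vertices of
    degree at least [2 ^ i]. *)
Definition class_bound i := r * 2 ^ (8 * s - i).

(** The slots, with twice as many slots in each class as guest vertices that they may
    receive. *)
Definition slot := {i : 'I_s & 'I_(2 * class_bound i)}.

Definition slot_class (x : slot) : nat := tag x.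

(** The binary logarithm of [K]; the stars of class at most [log_threshold] are sparse,
    those of higher classes are complete. *)
Definition log_threshold := trunc_log 2 (s %/ r).

(** The stars of class [i] have density [2 ^ - log_sparsity i]. *)
Definition log_sparsity i := 2 ^ log_threshold %/ 2 ^ i.

Lemma card_slot_tag (P : pred nat) :
  #|[set x | P (slot_class x)]| = \sum_(i < s | P i) 2 * class_bound i.
Proof.
transitivity (\sum_(i < s | P i) \sum_(j < 2 * class_bound i) 1); last first.
  by apply: eq_bigr => i _; rewrite sum1_card card_ord.
by rewrite sig_big_dep /= -sum1dep_card; apply: eq_bigl => x; rewrite andbT.
Qed.

Lemma card_slot_class i : i < s -> #|[set x | slot_class x == i]| = 2 * class_bound i.
Proof.
move=> ltis; rewrite (card_slot_tag (fun j => j == i)).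
by rewrite (big_pred1 (Ordinal ltis)).
Qed.

Lemma card_slots_above i : i < s -> #|[set x | i <= slot_class x]| <= 4 * class_bound i.
Proof.
move=> ltis; rewrite (card_slot_tag (fun j => i <= j)).
rewrite -(@big_geq_mkord _ _ _ i s xpredT (fun j => 2 * class_bound j)) /=.
have := @sum_half_powers (8 * s) i s; rewrite (ltnW ltis) leq_pmull // => /(_ isT).
rewrite -(leq_pmul2l (_ : 0 < 2 * r)) ?muln_gt0 //.
rewrite big_distrr /= => le.
under eq_bigr do rewrite /class_bound mulnA.
by rewrite (leq_trans le) // /class_bound; lia.
Qed.

Lemma card_slot : #|{: slot}| <= 4 * (r * 2 ^ (8 * s)).
Proof.
have s_gt0 : 0 < s by apply: leq_trans r_le_s.
have := card_slots_above s_gt0; rewrite /class_bound subn0; apply: leq_trans.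
by apply: subset_leq_card; apply/subsetP=> x; rewrite inE.
Qed.

(** The number of disjoint sets in the hitting property. *)
Definition family_size := 2 ^ (5 * s).

(** A bound on the number of neighbours of a vertex of degree less than [2 ^ s]. *)
Definition degree_bound := r * 2 ^ s.

(** Each star has at most about twice its expected size [#|Y| / q_i], with [Y] the
    set of slots of class at least [i]. *)
Definition sparse (A : slot -> {set slot}) : Prop := forall x,
  #|A x| * 2 ^ log_sparsity (slot_class x) <= 8 * class_bound (slot_class x).

(** In [hitting], the densities are the inverses of the successors of the first two
    arguments, here of [2 ^ log_sparsity i] and [2 ^ (4 * s)]. *)
Definition class_hitting (A : slot -> {set slot}) i : Prop :=
  hitting (2 ^ log_sparsity i).-1 (2 ^ (4 * s)).-1 family_size degree_bound
    (class_bound i) [set x | slot_class x == i] [set x | i <= slot_class x] A.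

Lemma exists_host_sets : exists A : slot -> {set slot},
  sparse A /\ forall i, i < s -> class_hitting A i.
Proof.
have exp_pred k : (2 ^ k).-1.+1 = 2 ^ k by rewrite prednK // expn_gt0.
have s_gt0 : 0 < s by apply: leq_trans r_le_s.
have /fin_all_exists[A AP] (i : 'I_s) : exists A : {ffun slot -> {set slot}},
    (forall x, #|A x| * (2 ^ log_sparsity i).-1.+1 <= 2 * #|[set y | i <= slot_class y]|)
    /\ class_hitting A i.
  apply: exists_hitting_sets.
  - by rewrite card_slot_class.
  - set Q := (2 ^ (4 * s)).-1.
    have Q0 : 0 < Q.
      by rewrite /Q -ltnS exp_pred -{1}(expn0 2) ltn_exp2l // muln_gt0.
    have -> : family_size = Q.+1 * 2 ^ s.
      by rewrite /Q exp_pred -expnD /family_size; congr (2 ^ _); lia.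
    rewrite expnM [leqRHS]expnM.
    rewrite (leq_trans _ (_ : (2 * Q ^ Q.+1) ^ 2 ^ s <= _)) //; last first.
      by rewrite leq_exp2r ?expn_gt0 // double_exp_pred.
    rewrite expnMn leq_mul2r (_ : 32 = 2 ^ 5) // leq_exp2l //.
    by rewrite (_ : 5 <= 2 ^ s) ?orbT //; lia.
  - have leT : #|{: slot}|.+1 <= 2 ^ (9 * s).
      have := card_slot; rewrite (_ : 9 * s = 8 * s + s) ?expnD; last by lia.
      have : 0 < 2 ^ (8 * s) by rewrite expn_gt0.
      by move: s_big r_le_s r_gt0; nia.
    apply: (@leq_ltn_trans (((2 ^ (9 * s)) ^ degree_bound) ^ family_size)).
      by rewrite leq_exp2r ?expn_gt0 // leq_exp2r // muln_gt0 expn_gt0 r_gt0.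
    rewrite -!expnM (_ : 4 = 2 ^ 2) // -expnM ltn_exp2l //.
    have lei : 2 ^ (7 * s) <= 2 ^ (8 * s - i).
      by rewrite leq_exp2l //; have := ltn_ord i; lia.
    rewrite /class_bound /degree_bound /family_size.
    apply: (@leq_trans (2 * (r * 2 ^ (7 * s)))); last first.
      by rewrite !leq_pmul2l.
    have -> : 2 ^ (7 * s) = 2 ^ s * 2 ^ s * 2 ^ (5 * s).
      by rewrite -!expnD; congr (2 ^ _); lia.
    have e1 : 0 < 2 ^ s by rewrite expn_gt0.
    have e5 : 0 < 2 ^ (5 * s) by rewrite expn_gt0.
    have e15 : 0 < r * 2 ^ s * 2 ^ (5 * s) by rewrite !muln_gt0 r_gt0 e1.
    have -> : 2 * (r * (2 ^ s * 2 ^ s * 2 ^ (5 * s)))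
        = 2 * 2 ^ s * (r * 2 ^ s * 2 ^ (5 * s)) by lia.
    by rewrite ltn_mul2r e15 /=; lia.
exists (fun x => A (tag x) x); split=> [x|i ltis X ss XC leX szss small].
  have [/(_ x) + _] := AP (tag x); rewrite exp_pred => /leq_trans-> //.
  have := card_slots_above (ltn_ord (tag x)); rewrite /slot_class; lia.
have [_ hit] := AP (Ordinal ltis).
have [x xX [S Sss SA]] := hit X ss XC leX szss small.
exists x => //; exists S => //; rewrite (_ : tag x = Ordinal ltis) //.
by apply: val_inj; apply/eqP; have := subsetP XC x xX; rewrite inE.
Qed.

(** A bound on the total number of guest vertices that have degree at least [2 ^ s]
    or fail in their class. *)
Definition spare := r * 2 ^ (7 * s) + s * (family_size * (degree_bound * degree_bound)).

(** The slots and the spare vertices; one more spare vertex than needed makes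
    [inord] available. *)
Definition host_vertex := (slot + 'I_spare.+1)%type.

(** Every [r]-set containing a spare vertex is a star centred there. *)
Definition host_star (A : slot -> {set slot}) (z : host_vertex) : {set host_vertex} :=
  if z is inl x then inl @: A x else setT.

Definition host A : hypergraph r := star_hypergraph (host_star A) r.

(** A vertex of class [i] has few enough neighbours for their images to be contained
    in a star of class [i] with probability at least [2 ^ - (4 * s)]. *)
Lemma log_sparsity_degree i k : k < 2 ^ i.+1 -> log_sparsity i * (r * k) <= 4 * s.
Proof.
move=> ltk; have le1 : log_sparsity i * 2 ^ i <= 2 ^ log_threshold by apply: leq_divM.
have sr : 0 < s %/ r by rewrite divn_gt0.
have le2 : 2 ^ log_threshold * r <= s.
  by rewrite (leq_trans _ (leq_divM s r)) // leq_mul2r trunc_logP ?orbT.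
rewrite expnS in ltk.
have := leq_mul (leqnn (log_sparsity i * r)) (ltnW ltk).
have := leq_mul le1 (leqnn (2 * r)); lia.
Qed.

Lemma host_universal A : (forall i, i < s -> class_hitting A i) ->
  universal (@edge_family r (2 ^ (8 * s))) (host A).
Proof.
move=> hitA F [leEm iso].
have s_gt0 : 0 < s by apply: leq_trans r_le_s.
have deg_gt0 := degree_gt0 iso.
pose low := [set v : vertex F | degree v < 2 ^ s].
pose cl (v : vertex F) := trunc_log 2 (degree v).
pose lecl := relpre cl leq.
have lecl_total : total lecl by move=> u v; apply: leq_total.
have lecl_trans : transitive lecl by move=> u v w; apply: leq_trans.
pose vs := sort lecl (enum low).
have memvs v : (v \in vs) = (degree v < 2 ^ s) by rewrite mem_sort mem_enum inE.
have uvs : uniq vs by rewrite sort_uniq enum_uniq.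
have pvs : pairwise lecl vs by rewrite -sorted_pairwise ?sort_sorted.
have [f fP] := greedy_exists (edges F) slot_class A uvs pvs.
have clP v : 2 ^ cl v <= degree v < 2 ^ (cl v).+1.
  exact: trunc_log_bounds (deg_gt0 v).
have cl_lt v : v \in vs -> cl v < s.
  rewrite memvs => ltv; have /andP[le _] := clP v.
  by have := leq_ltn_trans le ltv; rewrite ltn_exp2l.
(* The vertices to be sent to spare vertices: those of high degree and the failures. *)
pose failed := [set v | f v == None].
have few : #|failed| <= spare.
  pose high := [set v : vertex F | 2 ^ s <= degree v].
  pose failed_in i := [set v in vs | (cl v == i) && (f v == None)].
  have lehigh : #|high| <= r * 2 ^ (7 * s).
    rewrite -(@leq_pmul2r (2 ^ s)) ?expn_gt0 // -mulnA -expnD.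
    rewrite (_ : 7 * s + s = 8 * s); last by lia.
    by apply: card_degree_geq => // v; rewrite inE.
  have lefailed i : i < s -> #|failed_in i| <= family_size * (degree_bound * degree_bound).
    move=> ltis; apply: (greedy_few_failures (n := class_bound i) fP _ _ _ _ _ (hitA i ltis)).
    - by rewrite muln_gt0 r_gt0 expn_gt0.
    - by rewrite card_slot_class.
    - rewrite -(@leq_pmul2r (2 ^ i)) ?expn_gt0 // /class_bound -mulnA -expnD.
      rewrite subnK; last by lia.
      by apply: card_degree_geq => // v; rewrite inE => /andP[_ /eqP<-]; case/andP: (clP v).
    - move=> v; rewrite memvs => /ltnW le; rewrite (leq_trans (card_neighbours v)) //.
      by rewrite leq_mul2l le orbT.
    - move=> v _ clv; rewrite !prednK ?expn_gt0 // -expnM leq_exp2l //.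
      have ltd : degree v < 2 ^ i.+1 by rewrite -clv; case/andP: (clP v).
      apply: leq_trans (log_sparsity_degree ltd).
      by rewrite leq_mul2l card_neighbours orbT.
  have sub : failed \subset high :|: \bigcup_(i < s) failed_in i.
    apply/subsetP=> v; rewrite !inE => fv; case: leqP => //= ltv.
    have vvs : v \in vs by rewrite memvs.
    by apply/bigcupP; exists (Ordinal (cl_lt v vvs)); rewrite // inE vvs eqxx fv.
  apply: leq_trans (subset_leq_card sub) _; apply: leq_trans (leq_card_setU _ _) _.
  apply: leq_add => //; apply: leq_trans (card_bigcup_leq _ _ _) _.
  rewrite -[s in s * _]card_ord -sum_nat_const; apply: leq_sum => i _; exact: lefailed.
pose h v : 'I_spare.+1 := inord (index v (enum failed)).
have h_inj : {in failed &, injective h}.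
  move=> u v uf vf /(congr1 val) /=; rewrite !inordK; first last.
  - by rewrite ltnS (leq_trans _ few) // cardE index_size.
  - by rewrite ltnS (leq_trans _ few) // cardE index_size.
  by apply: index_inj; rewrite ?topredE /= ?mem_enum.
pose g v : host_vertex := if f v is Some x then inl x else inr (h v).
have g_inj : injective g.
  move=> u v; rewrite /g; case fu: (f u) => [x|]; case fv: (f v) => [y|] //.
    by case=> xy; apply: (greedy_inj fP fu); rewrite xy.
  by case=> /h_inj-> //; rewrite inE ?fu ?fv.
exists g; split=> // e eF; rewrite inE card_imset // edges_uniform // eqxx /=.
have e0 : e != set0 by rewrite -card_gt0 edges_uniform.
have [/exists_inP[u ue /eqP fu]|/exists_inPn none] := boolP [exists u in e, f u == None].
  apply/exists_inP; exists (g u); first exact: imset_f.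
  have -> : g u = inr (h u) by rewrite /g fu.
  exact: subsetT.
have [v ve [x fv vA]] := greedy_edge fP eF e0 none.
apply/exists_inP; exists (g v); first exact: imset_f.
apply/subsetP=> z /setD1P[zv /imsetP[u ue zu]].
have uv : u != v by rewrite -(inj_eq g_inj) -zu.
have : f u != None by apply: none.
rewrite zu /g fv /=; case fu: (f u) => [y|] // _; apply: imset_f.
exact: vA fu.
Qed.

Lemma log_threshold_lt : log_threshold < s.
Proof.
rewrite -(@ltn_exp2l 2) //.
have sr : 0 < s %/ r by rewrite divn_gt0.
rewrite (leq_ltn_trans (trunc_logP _ sr)) // (leq_ltn_trans (leq_div s r)) //.
exact: ltn_expl.
Qed.

(** The exponent form of the decay of the contribution of class [j] away from
    [log_threshold]. *)
Lemma sparsity_exponent j : 2 < r -> j < s ->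
  (8 * s - j) * r + log_threshold * r + ((j - log_threshold) + (log_threshold - j))
    <= 8 * s * r + log_sparsity j * r.-1.
Proof.
set k := log_threshold.
move=> r_gt2 ltjs; rewrite /log_sparsity -/k.
have [lejk|ltkj] := leqP j k.
  rewrite -expnB //; set a := k - j.
  have le2 : 2 * a <= 2 ^ a.
    by case: (a) => // b; rewrite expnS leq_pmul2l // ltn_expl.
  have -> : k = j + a by rewrite subnKC.
  have : a * r.+1 <= 2 ^ a * r.-1.
    rewrite (leq_trans _ (leq_mul le2 (leqnn _))) // -[2 * a]mulnC -mulnA leq_mul2l.
    by apply/orP; right; lia.
  have : j <= 8 * s by lia.
  nia.
have -> : 8 * s * r = (8 * s - j + k + (j - k)) * r by congr (_ * r); lia.
rewrite !mulnDl (_ : k - j = 0); last by lia.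
by rewrite addn0 (leq_trans _ (leq_addr _ _)) // leq_add2l leq_pmulr.
Qed.

Lemma sum_sparse A : 2 < r -> sparse A ->
  (\sum_x #|A x| ^ r.-1) * (2 ^ log_threshold) ^ r
    <= 4 * ((8 * r) ^ r * (2 ^ (8 * s)) ^ r).
Proof.
move=> r_gt2 spA; set K := (8 * r) ^ r * _; set k := log_threshold.
(* [dist j] is the distance from [j] to [k], as one of the differences vanishes. *)
pose dist j := (j - k) + (k - j).
(* [2 * class_bound i] is the number of slots of the class: [K] bounds the class
   total if each slot contributes as much as [x]. *)
have per_slot x (i := slot_class x) :
    2 * class_bound i * (#|A x| ^ r.-1 * 2 ^ (k * r + dist i)) <= K.
  have lti : i < s by apply: ltn_ord.
  have leA := spA x; rewrite -/i in leA.
  have : (#|A x| * 2 ^ log_sparsity i) ^ r.-1 * (8 * class_bound i) <= (8 * class_bound i) ^ r.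
    rewrite -{2}(prednK r_gt0) expnSr leq_mul2r; apply/orP; right.
    by case: r.-1 => // n; rewrite leq_exp2r.
  rewrite expnMn -(expnM 2) => le1.
  have le2 : (8 * class_bound i) ^ r * 2 ^ (k * r + dist i)
      <= K * 2 ^ (log_sparsity i * r.-1).
    rewrite /class_bound (mulnA 8 r) (expnMn (8 * r)) /K -2!(mulnA ((8 * r) ^ r)).
    rewrite leq_mul2l -!expnM -!expnD leq_exp2l //.
    by rewrite addnA (sparsity_exponent r_gt2 lti) orbT.
  have e0 : 0 < 2 ^ (log_sparsity i * r.-1) by rewrite expn_gt0.
  rewrite -(leq_pmul2r e0); apply: leq_trans le2.
  have := leq_mul le1 (leqnn (2 ^ (k * r + dist i))).
  apply: leq_trans; set a := #|_| ^ _; set b := 2 ^ (k * r + _); set c := 2 ^ _.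
  rewrite (_ : a * c * _ * b = 4 * (2 * class_bound i * (a * b) * c)); last by lia.
  exact: leq_pmull.
have per_class (i : 'I_s) :
    (\sum_(x | slot_class x == i) #|A x| ^ r.-1) * 2 ^ (k * r) * 2 ^ s <= K * 2 ^ (s - dist i).
  have n0 : 0 < 2 * class_bound i by rewrite !muln_gt0 r_gt0 expn_gt0.
  have lesum : (\sum_(x | slot_class x == i) #|A x| ^ r.-1) * 2 ^ (k * r + dist i) <= K.
    rewrite -(leq_pmul2l n0) big_distrl big_distrr /=.
    apply: (@leq_trans (\sum_(x | slot_class x == i) K)).
      by apply: leq_sum => x /eqP <-; apply: per_slot.
    by rewrite sum_nat_cond_const card_slot_class.
  have dist_le : dist i <= s.
    by have := ltn_ord i; have := log_threshold_lt; rewrite -/k /dist; lia.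
  rewrite (_ : 2 ^ s = 2 ^ dist i * 2 ^ (s - dist i)); last by rewrite -expnD subnKC.
  by rewrite mulnA -[X in X * _]mulnA -expnD leq_mul2r lesum orbT.
have geom : \sum_(i < s) 2 ^ (s - dist i) <= 4 * 2 ^ s.
  have ks := log_threshold_lt; rewrite -/k in ks.
  rewrite -(big_mkord xpredT (fun i => 2 ^ (s - dist i))).
  rewrite (@big_cat_nat _ _ _ k) //=; last exact: ltnW.
  have up : \sum_(k <= i < s) 2 ^ (s - dist i) <= 2 * 2 ^ s.
    have := @sum_half_powers (s + k) k s; rewrite (ltnW ks) leq_addr addnK => /(_ isT).
    apply: leq_trans; rewrite !big_nat; apply: leq_sum => i /andP[ki _].
    by rewrite leq_exp2l // /dist; lia.
  have down : \sum_(0 <= i < k) 2 ^ (s - dist i) <= 2 * 2 ^ s.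
    have := @sum_half_powers s 0 k; rewrite (ltnW ks) subn0 => /(_ isT).
    apply: leq_trans; rewrite big_nat_rev /= !big_nat; apply: leq_sum => i /andP[_ ik].
    by rewrite leq_exp2l // /dist; lia.
  by rewrite (leq_trans (leq_add down up)) //; lia.
rewrite -expnM -(@leq_pmul2r (2 ^ s)) ?expn_gt0 //.
rewrite (partition_big (fun x => tag x) xpredT) //= !big_distrl /=.
apply: (@leq_trans (\sum_(i < s) K * 2 ^ (s - dist i))).
  by apply: leq_sum => i _; apply: per_class.
by rewrite -big_distrr /= [4 * K]mulnC -mulnA leq_mul2l geom orbT.
Qed.

Lemma card_host_edges A : 2 < r -> sparse A ->
  #|edges (host A)| * s ^ r
    <= (4 * (2 * r) ^ r * (8 * r) ^ r
        + 3 * r ^ 2 * (7 * r ^ 2) ^ r.-1 * r.+1 ^ r.+1) * (2 ^ (8 * s)) ^ r.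
Proof.
move=> r_gt2 spA.
have s_gt0 : 0 < s by apply: leq_trans r_le_s.
have le_s : s <= 2 * r * 2 ^ log_threshold.
  have := trunc_log_ltn (s %/ r) (ltnSn 1); rewrite -/log_threshold ltn_divLR // expnS; lia.
have le_spare : spare.+1 <= 3 * r ^ 2 * s * 2 ^ (7 * s).
  rewrite /spare /family_size /degree_bound (_ : 7 * s = 5 * s + (s + s)) ?expnD; last by lia.
  have := expn_gt0 2 (5 * s); have := expn_gt0 2 s; rewrite !orTb.
  set a := 2 ^ (5 * s); set b := 2 ^ s => a0 b0.
  have ab : 0 < a * (b * b) by rewrite !muln_gt0 a0 b0.
  have rr : r <= r ^ 2 * s by rewrite -mulnn; nia.
  have := leq_mul rr (leqnn (a * (b * b))).
  have : r ^ 2 * s * (a * (b * b)) = s * (a * (r * b * (r * b))) by rewrite -mulnn; lia.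
  nia.
have le_vertex : #|{: host_vertex}| <= 7 * r ^ 2 * 2 ^ (8 * s).
  rewrite card_sum card_ord.
  have := card_slot; have : s * 2 ^ (7 * s) <= 2 ^ (8 * s).
    by rewrite (_ : 8 * s = s + 7 * s) ?expnD; [rewrite leq_mul2r ltnW ?orbT // ltn_expl|lia].
  have := expn_gt0 2 (8 * s); rewrite orTb; have : r <= r ^ 2 by rewrite -mulnn leq_pmulr.
  move: le_spare; set a := 2 ^ (7 * s); set b := 2 ^ (8 * s); set q := r ^ 2.
  move=> h1 h2 h3 h4 h5; have := leq_mul h2 (leqnn b); have := leq_mul (leqnn (3 * q)) h4.
  move=> h6 h7; rewrite (leq_trans (leq_add h5 h1)) //; lia.
apply: leq_trans (leq_mul (card_star_edges _ _) (leqnn _)) _.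
rewrite big_sumType /= [leqLHS]mulnDl [leqRHS]mulnDl; apply: leq_add.
  rewrite (eq_bigr (fun x => #|A x| ^ r.-1)); last first.
    by move=> x _; rewrite card_imset // => y z [].
  apply: (@leq_trans ((\sum_x #|A x| ^ r.-1) * (2 * r * 2 ^ log_threshold) ^ r)).
    by rewrite leq_mul2l leq_exp2r ?le_s ?orbT.
  rewrite expnMn mulnCA; have := leq_mul (leqnn ((2 * r) ^ r)) (sum_sparse r_gt2 spA); lia.
rewrite sum_nat_const card_ord cardsT.
have le_spare_s : spare.+1 * s ^ r <= 3 * r ^ 2 * r.+1 ^ r.+1 * 2 ^ (8 * s).
  have := leq_mul le_spare (leqnn (s ^ r)).
  have := exp_leq_exp2 s r.+1; rewrite (expnS s).
  have -> : 2 ^ (8 * s) = 2 ^ (7 * s) * 2 ^ s by rewrite -expnD; congr (2 ^ _); lia.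
  set x := s ^ r; set y := r.+1 ^ r.+1; set z := 2 ^ s; set a := 2 ^ (7 * s) => h1 h2.
  have := leq_mul (leqnn (3 * r ^ 2 * a)) h1; lia.
have lepow : #|{: host_vertex}| ^ r.-1 <= (7 * r ^ 2 * 2 ^ (8 * s)) ^ r.-1.
  by rewrite leq_exp2r //; lia.
rewrite mulnAC; apply: leq_trans (leq_mul le_spare_s lepow) _.
have -> : (2 ^ (8 * s)) ^ r = 2 ^ (8 * s) * (2 ^ (8 * s)) ^ r.-1.
  by rewrite -expnS prednK.
rewrite expnMn.
set x := (7 * _) ^ _; set y := r.+1 ^ r.+1; set z := 2 ^ _; set w := z ^ _; lia.
Qed.

End Host.

(** * Universal hypergraphs with few edges *)

(** The complete [r]-uniform hypergraph on [r * m] vertices is universal. *)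
Lemma complete_host r m : 0 < r ->
  exists H : hypergraph r,
    universal (@edge_family r m) H /\ #|edges H| <= (r * m) ^ r.
Proof.
move=> r_gt0; exists (star_hypergraph (fun _ : 'I_(r * m) => setT) r); split.
  move=> F [leEm iso].
  have leV : #|vertex F| <= r * m.
    rewrite -cardsT -[leqLHS]muln1; apply: card_degree_geq => // v _.
    exact: degree_gt0.
  have f_inj : injective (fun v => widen_ord leV (enum_rank v)).
    by apply: inj_comp enum_rank_inj => i j /(congr1 val) /= ij; apply: val_inj.
  exists (fun v => widen_ord leV (enum_rank v)); split=> // e eF.
  rewrite inE card_imset // edges_uniform // eqxx /=.
  have /card_gt0P[v ve] : 0 < #|e| by rewrite edges_uniform.
  apply/exists_inP; exists (widen_ord leV (enum_rank v)); last exact: subsetT.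
  exact: (imset_f (fun v => widen_ord leV (enum_rank v))).
apply: leq_trans (card_star_edges _ _) _.
by rewrite sum_nat_const cardsT card_ord -expnS prednK.
Qed.

(** The bound for guests with at most [2 ^ (8 * s)] edges; complete hypergraphs serve for the finitely many
    [s] below [r + 6]. *)
Lemma universal_of_power r : 2 < r ->
  exists2 C, 0 < C & forall s, exists H : hypergraph r,
    universal (@edge_family r (2 ^ (8 * s))) H
    /\ #|edges H| * s ^ r <= C * (2 ^ (8 * s)) ^ r.
Proof.
move=> r_gt2; have r_gt0 : 0 < r by lia.
pose C1 := 4 * (2 * r) ^ r * (8 * r) ^ r + 3 * r ^ 2 * (7 * r ^ 2) ^ r.-1 * r.+1 ^ r.+1.
pose C2 := r ^ r * (r + 6) ^ r.
exists (C1 + C2); first by rewrite addn_gt0 orbC muln_gt0 !expn_gt0 addn_gt0 r_gt0.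
move=> s; have [small|large] := ltnP s (r + 6).
  have [H [univ leH]] := complete_host (2 ^ (8 * s)) r_gt0.
  exists H; split=> //; rewrite mulnDl (leq_trans _ (leq_addl _ _)) //.
  rewrite (leq_trans (leq_mul leH (leqnn _))) // expnMn /C2 mulnAC leq_mul2r.
  by rewrite leq_mul2l leq_exp2r // (ltnW small) !orbT.
have rs : r <= s by lia.
have s_big : 9 * s < 2 ^ s.
  have : 6 <= s by lia.
  elim: (s) => // n IHn; rewrite leq_eqVlt => /predU1P[<-//|le6n].
  by have := IHn le6n; rewrite ltnS in le6n; rewrite expnS; lia.
have [A [spA hitA]] := exists_host_sets r_gt0 rs s_big.
exists (host A); split; first exact: host_universal.
rewrite mulnDl (leq_trans _ (leq_addr _ _)) //; exact: card_host_edges.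
Qed.

Local Open Scope ring_scope.

Theorem theorem1p4 (R : realType) (r : nat) (hr : (3 <= r)%N) :
  exists C : R, 0 < C /\
    forall m : nat, (2 <= m)%N ->
      exists H : hypergraph r,
        universal (@edge_family r m) H /\
        #|edges H|%:R <= C * (m%:R ^+ r / ln (m%:R : R) ^+ r).
Proof.
have [C C_gt0 hostC] := universal_of_power hr.
exists (C * (8 * 2 ^ 8) ^ r)%N%:R; split.
  by rewrite ltr0n muln_gt0 C_gt0 expn_gt0.
move=> m m_ge2.
(* [8 * s] is the least multiple of 8 with [m < 2 ^ (8 * s)]; hence
   [2 ^ (8 * s) <= 2 ^ 8 * m]. *)
set s := (trunc_log 2 m %/ 8).+1.
have m_gt0 : (0 < m)%N by apply: leq_trans m_ge2.
have lt_m : (m < 2 ^ (8 * s))%N.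
  apply: leq_trans (trunc_log_ltn m (ltnSn 1)) _.
  by rewrite leq_exp2l // mulnC ltn_ceil.
have le_m : (2 ^ (8 * s) <= 2 ^ 8 * m)%N.
  rewrite /s mulnS expnD leq_mul2l /= (leq_trans _ (trunc_logP (ltnSn 1) m_gt0)) //.
  by rewrite leq_exp2l // mulnC leq_divM.
have [H [univ leH]] := hostC s; exists H; split.
  by move=> F [leE iso]; apply: univ; split=> //; apply: leq_trans leE (ltnW lt_m).
have ln_gt0 : 0 < ln (m%:R : R) by rewrite ln_gt0 // ltr1n.
have ln_le : ln (m%:R : R) <= (8 * s)%:R.
  have le2 : ln (2 : R) <= 1 := le_ln1Dx (lt_trans (ltrN10 R) ltr01).
  apply: (@le_trans _ _ (ln ((2 ^ (8 * s))%:R : R))).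
    by rewrite ler_ln ?posrE ?ltr0n ?expn_gt0 // ler_nat ltnW.
  by rewrite natrX lnXn // -[leLHS]mulr_natl -[leRHS]mulr1 ler_wpM2l.
rewrite mulrA ler_pdivlMr ?exprn_gt0 //.
apply: (@le_trans _ _ (#|edges H|%:R * (8 * s)%:R ^+ r)).
  by rewrite ler_wpM2l ?ler0n // lerXn2r ?nnegrE ?ler0n // ltW.
rewrite -!natrX -!natrM ler_nat (expnMn 8 s) mulnCA.
rewrite (leq_trans (leq_mul (leqnn (8 ^ r)) leH)) //.
have : ((2 ^ (8 * s)) ^ r <= (2 ^ 8 * m) ^ r)%N by rewrite leq_exp2r ?le_m //; lia.
rewrite (expnMn (2 ^ 8) m) (expnMn 8 (2 ^ 8)) => /(leq_mul (leqnn (8 ^ r * C))).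
set a := (8 ^ r)%N; set b := ((2 ^ (8 * s)) ^ r)%N; set c := ((2 ^ 8) ^ r)%N.
by set d := (m ^ r)%N; lia.
Qed.
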